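(* Let $d\ge 2$, let $\mathcal{H}$ be a $d$-dimensional complex Hilbert space, and let $\mathbb{P}=\{\mathcal{P}^{(1)},\ldots,\mathcal{P}^{(M)}\}$ be a set of $M$ mutually unbiased measurements of efficiency $\varkappa$ on $\mathcal{H}$. Then for every $\alpha\in[2,\infty]$ and every density matrix $\rho$ on $\mathcal{H}$ (pure or mixed), the following state-independent bound holds: $$\frac{1}{M}\sum_{\mathcal{P}\in\mathbb{P}} R_{\alpha}(\mathcal{P}|\rho)\;\geq\;\frac{1}{\alpha-1}\,\ln\!\left(\frac{Md}{M+\varkappa d-1}\right)+\frac{\alpha-2}{\alpha-1}\left\{\ln d-\ln\!\left(1+M^{-1/2}\sqrt{\varkappa d-1}\,\sqrt{d-1}\right)\right\},$$ where for $\alpha=\infty$ the coefficients are understood as their limits, $\frac{1}{\alpha-1}=0$ and $\frac{\alpha-2}{\alpha-1}=1$.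
   Context: A density matrix on $\mathcal{H}$ is a positive semidefinite operator $\rho$ with $\mathrm{Tr}(\rho)=1$. A POVM with $d$ elements is a family of positive semidefinite operators $\{P_n\}_{n=1}^d$ on $\mathcal{H}$ with $\sum_n P_n=I$ (the identity). A set $\mathbb{P}=\{\mathcal{P}^{(1)},\ldots,\mathcal{P}^{(M)}\}$ of POVMs $\mathcal{P}^{(b)}=\{P^{(b)}_n\}_{n=1}^d$, each with $d$ elements (an indexed family, $b=1,\dots,M$), is a set of $M$ mutually unbiased measurements (MUMs) of efficiency $\varkappa$ if: (i) $\mathrm{Tr}(P^{(b)}_n)=1$ for all $b,n$; (ii) $\mathrm{Tr}(P^{(a)}_mP^{(b)}_n)=\frac1d$ for all $a\neq b$ and all $m,n$; (iii) for all $b,m,n$, $\mathrm{Tr}(P^{(b)}_mP^{(b)}_n)=\delta_{mn}\,\varkappa+(1-\delta_{mn})\frac{1-\varkappa}{d-1}$. Here $\varkappa$ is a real parameter, for which $1/d\le\varkappa\le 1$. Sums over $\mathcal{P}\in\mathbb{P}$ mean sums over $b=1,\dots,M$. For a POVM $\mathcal{P}=\{P_n\}_{n=1}^d$ and density matrix $\rho$, the outcome probabilities are $p_n(\mathcal{P}|\rho)=\mathrm{Tr}(P_n\rho)$, and $R_\alpha(\mathcal{P}|\rho)$ denotes the Rényi $\alpha$-entropy of this distribution: $R_{\alpha}(p)=\frac{1}{1-\alpha}\ln\left(\sum_n p_n^{\alpha}\right)$ for finite $\alpha>0$, $\alpha\neq1$, and $R_\infty(p)=-\ln(\max_n p_n)$.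 *)

(* Defs.v *)
From HB Require Import structures.
From mathcomp Require Import all_boot all_order all_algebra.
From mathcomp Require Import all_classical all_reals all_analysis.
From mathcomp Require Import complex.

Set Implicit Arguments.
Unset Strict Implicit.
Unset Printing Implicit Defensive.

Import Order.TTheory GRing.Theory Num.Theory.

Local Open Scope ring_scope.
Local Open Scope complex_scope.
Local Open Scope sesquilinear_scope.

(* A d-dimensional complex Hilbert space is C^d with its standard inner
   product, where C = R[i]; operators are d x d matrices over R[i], and
   A ^t* is the adjoint of A.  The order on R[i] is partial:
   0 <= z means that z is real and nonnegative. *)

Definition psdmx (R : realType) (d : nat) (A : 'M[R[i]]_d) : Prop :=
  A \is hermsymmx /\ forall v : 'cV[R[i]]_d, 0 <= (v ^t* *m A *m v) 0 0.

Definition density_matrix (R : realType) (d : nat) (rho : 'M[R[i]]_d) : Prop :=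
  psdmx rho /\ \tr rho = 1.

Definition povm (R : realType) (d : nat) (P : 'I_d -> 'M[R[i]]_d) : Prop :=
  (forall n, psdmx (P n)) /\ \sum_(n < d) P n = 1%:M.

Definition mutually_unbiased_measurements (R : realType) (d M : nat)
    (kappa : R) (P : 'I_M -> 'I_d -> 'M[R[i]]_d) : Prop :=
  [/\ forall b, povm (P b),
      forall b n, \tr (P b n) = 1,
      forall a b m n, a != b -> \tr (P a m *m P b n) = (d%:R^-1 : R)%:C
    & forall b m n, \tr (P b m *m P b n) =
        ((m == n)%:R * kappa
         + (1 - (m == n)%:R) * ((1 - kappa) / (d%:R - 1)))%:C].

(* For positive semidefinite P n and rho the trace is already real, so that
   taking the real part only changes its type. *)
Definition outcome_prob (R : realType) (d : nat) (P : 'I_d -> 'M[R[i]]_d)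
    (rho : 'M[R[i]]_d) (n : 'I_d) : R :=
  complex.Re (\tr (P n *m rho)).

(* Meaningful for 0 < alpha, alpha != 1; the values at other alpha are
   junk.  The maximum may start from 0 since probabilities are nonnegative. *)
Definition renyi_entropy (R : realType) (d : nat) (alpha : \bar R)
    (p : 'I_d -> R) : R :=
  match alpha with
  | EFin a => (1 - a)^-1 * ln (\sum_(n < d) p n `^ a)
  | +oo%E => - ln (\big[Num.max/0]_(n < d) p n)
  | -oo%E => 0
  end.

(* 1 / (alpha - 1) and (alpha - 2) / (alpha - 1), extended to alpha = +oo by
   their limits; the values at -oo are junk. *)
Definition inv_subr1 (R : realType) (alpha : \bar R) : R :=
  if alpha is EFin a then (a - 1)^-1 else 0.

Definition subr2_div_subr1 (R : realType) (alpha : \bar R) : R :=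
  if alpha is EFin a then (a - 2) / (a - 1) else 1.

(* Main.v *)
(* For an outcome distribution p with index of coincidence C = sum p_n^2 and
   maximum m, sum p_n^alpha <= m^(alpha - 2) C bounds R_alpha below by a
   nonnegative combination of - ln C and - ln m.  Cauchy-Schwarz for the
   Hilbert-Schmidt inner product, together with tr rho^2 <= 1, gives
   sum_b C_b <= (M - 1)/d + kappa.  Since (d m_b - 1)^2 <= (d - 1)(d C_b - 1),
   this also bounds the mean of the m_b, and concavity of ln concludes. *)

Require Import Defs.
From HB Require Import structures.
From mathcomp Require Import all_boot all_order all_algebra.
From mathcomp Require Import all_classical all_reals all_analysis.
From mathcomp Require Import complex ring lra.

Set Implicit Arguments.
Unset Strict Implicit.
Unset Printing Implicit Defensive.

Import Order.TTheory GRing.Theory Num.Theory.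

Local Open Scope ring_scope.

(** * Jensen and Cauchy-Schwarz for real families *)

Lemma ln_mean_le (R : realType) (M : nat) (x : 'I_M -> R) (T : R) :
  (0 < M)%N -> (forall b, 0 < x b) -> 0 < T -> \sum_b x b <= M%:R * T ->
  M%:R^-1 * \sum_b ln (x b) <= ln T.
Proof.
move=> M_gt0 x_gt0 T_gt0 xT.
have M0 : 0 < M%:R :> R by rewrite ltr0n.
(* The tangent to [ln] at [T] lies above it; summed over [b], its linear terms are at most 0 by
   [xT]. *)
have ln_tangent b : ln (x b) <= ln T + (x b / T - 1).
  rewrite -lerBlDl -ln_div ?posrE// -[X in ln X](subrKC 1).
  by apply: le_ln1Dx; rewrite ltrBrDl subrr divr_gt0.
rewrite ler_pdivrMl//.
apply: le_trans (ler_sum _ (fun b _ => ln_tangent b)) _.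
rewrite !big_split/= !sumr_const card_ord -mulr_suml mulNrn.
rewrite -(mulr_natl (ln T)) -(mulr_natl 1) mulr1 gerDl subr_le0.
by rewrite ler_pdivrMr.
Qed.

(** The squared deviations from the mean have a nonnegative sum. *)
Lemma sqr_sum_le (R : realFieldType) (M : nat) (x : 'I_M -> R) :
  (\sum_b x b) ^+ 2 <= M%:R * \sum_b x b ^+ 2.
Proof.
case: M x => [|M] x; first by rewrite !big_ord0 mulr0 expr0n.
set s := \sum_b x b; have M0 : 0 < M.+1%:R :> R by rewrite ltr0n.
have : 0 <= \sum_b (x b - s / M.+1%:R) ^+ 2 by apply: sumr_ge0 => b _; exact: sqr_ge0.
under eq_bigr => b _.
  rewrite (_ : _ ^+ 2 = x b ^+ 2 + (- (2 * (s / M.+1%:R)) * x b + (s / M.+1%:R) ^+ 2));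
    last by ring.
  over.
rewrite !big_split/= sumr_const card_ord -mulr_sumr -/s -[_ *+ M.+1]mulr_natl.
rewrite -(pmulr_rge0 _ M0) => h; rewrite -subr_ge0; move: h; congr (0 <= _).
by field; rewrite addrC natr1 gt_eqF.
Qed.

(** Up to sign, [x k] is the sum of the other d - 1 entries. Apply [sqr_sum_le] to those, then add
    (d - 1) [x k ^+ 2] to both sides. *)
Lemma sum0_sqr_le (R : realFieldType) (d : nat) (x : 'I_d -> R) (k : 'I_d) :
  \sum_n x n = 0 -> d%:R * x k ^+ 2 <= (d%:R - 1) * \sum_n x n ^+ 2.
Proof.
case: d x k => [|d] x k; first by case: k.
rewrite -natr1 addrK (bigD1_ord k)//= => /eqP; rewrite addr_eq0 => /eqP xk.
have := sqr_sum_le (fun n => x (lift k n)).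
rewrite (bigD1_ord k)//= mulrDr mulrDl mul1r lerD2l => h.
by rewrite xk sqrrN.
Qed.

(** * Probability distributions and Rényi entropy *)

Lemma distr_bigmax (R : realType) (d : nat) (p : 'I_d -> R) :
  (forall n, 0 <= p n) -> \sum_n p n = 1 ->
  exists2 k, \big[Num.max/0]_n p n = p k & 0 < p k.
Proof.
move=> p_ge0 p1; set m := \big[_/_]_n _.
have m_ge n : p n <= m by exact: le_bigmax_cond.
have m_gt0 : 0 < m.
  rewrite ltNge; apply/negP => m_le0; move/eqP: p1; rewrite big1 => [|n _].
    by rewrite eq_sym oner_eq0.
  by apply/le_anti; rewrite p_ge0 (le_trans (m_ge n)).
(* The maximum is either the starting value 0 or an entry; positivity excludes the former. *)
have [k _ mk] : exists2 k, true & m = p k.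
  have : m = 0 \/ exists2 k, true & m = p k.
    rewrite /m; elim/big_rec: _ => [|n y _ IH]; first by left.
    by rewrite maxEle; case: ifP => _; [exact: IH | right; exists n].
  by case=> // m0; rewrite m0 ltxx in m_gt0.
by exists k => //; rewrite -mk.
Qed.

Lemma distr_index_of_coincidence_gt0 (R : realType) (d : nat) (p : 'I_d -> R) :
  (forall n, 0 <= p n) -> \sum_n p n = 1 -> 0 < \sum_n p n ^+ 2.
Proof.
move=> p_ge0 /(distr_bigmax p_ge0)[k _ pk_gt0].
rewrite (bigD1 k)//= ltr_pwDl ?exprn_gt0//.
by apply: sumr_ge0 => n _; exact: sqr_ge0.
Qed.

Lemma inv_subr1_ge0 (R : realType) (alpha : \bar R) :
  (2%:E <= alpha)%E -> 0 <= inv_subr1 alpha.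
Proof. by case: alpha => [a||]//=; rewrite lee_fin invr_ge0; lra. Qed.

Lemma subr2_div_subr1_ge0 (R : realType) (alpha : \bar R) :
  (2%:E <= alpha)%E -> 0 <= subr2_div_subr1 alpha.
Proof. by case: alpha => [a||]//=; rewrite lee_fin => a2; apply: divr_ge0; lra. Qed.

Lemma renyi_entropy_ge (R : realType) (d : nat) (alpha : \bar R) (p : 'I_d -> R) :
  (2%:E <= alpha)%E -> (forall n, 0 <= p n) -> \sum_n p n = 1 ->
  inv_subr1 alpha * - ln (\sum_n p n ^+ 2)
    + subr2_div_subr1 alpha * - ln (\big[Num.max/0]_n p n)
  <= renyi_entropy alpha p.
Proof.
case: alpha => [a||]//=; last by rewrite mul0r add0r mul1r.
rewrite lee_fin => a2 p_ge0 p1.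
have C_gt0 := distr_index_of_coincidence_gt0 p_ge0 p1.
have p_le n : p n <= \big[Num.max/0]_n p n by exact: le_bigmax_cond.
have [k mk pk_gt0] := distr_bigmax p_ge0 p1.
move: p_le; rewrite mk => p_le.
set C := \sum_n p n ^+ 2 in C_gt0 *.
have powE n : p n `^ a = p n `^ (a - 2) * p n ^+ 2.
  have [->|pn0] := eqVneq (p n) 0.
    by rewrite expr0n/= mulr0 powR0// gt_eqF//; lra.
  by rewrite -powR_mulrn// -powRD ?pn0 ?implybT// subrK.
have pow_le : \sum_n p n `^ a <= p k `^ (a - 2) * C.
  rewrite /C mulr_sumr; apply: ler_sum => n _; rewrite powE.
  by rewrite ler_wpM2r ?sqr_ge0// ge0_ler_powR ?nnegrE//; lra.
have pow_gt0 : 0 < \sum_n p n `^ a.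
  rewrite (bigD1 k)//= ltr_pwDl ?powR_gt0//.
  by apply: sumr_ge0 => n _; exact: powR_ge0.
have := pow_le; rewrite -ler_ln ?posrE ?mulr_gt0 ?powR_gt0//.
rewrite lnM ?posrE ?powR_gt0// ln_powR => ln_le.
have a1 : 0 < (a - 1)^-1 by rewrite invr_gt0; lra.
(* The prefactor 1/(1 - a) is negative, so the upper bound on the power sum becomes a lower bound on
   the entropy. *)
rewrite -[1 - a]opprB invrN mulNr -mulrN.
rewrite (_ : _ + _ = (a - 1)^-1 * - ((a - 2) * ln (p k) + ln C)); last by ring.
by rewrite ler_pM2l// lerN2.
Qed.

(** * Hermitian and positive semidefinite matrices *)

Local Open Scope complex_scope.
Local Open Scope sesquilinear_scope.

Lemma hermsymmx_trmxC (R : realType) (d : nat) (A : 'M[R[i]]_d) :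
  reflect (A ^t* = A) (A \is hermsymmx).
Proof.
by apply: (iffP (is_hermitianmxP _ _ _)); rewrite scale1r => /esym.
Qed.

(** Replacing one factor by its adjoint turns the trace into the sum of the squared moduli of the
    entries. *)
Lemma hermsymmx_mxtrace_sqr_ge0 (R : realType) (d : nat) (A : 'M[R[i]]_d) :
  A \is hermsymmx -> 0 <= \tr (A *m A).
Proof.
move=> /hermsymmx_trmxC Ah; rewrite -{2}Ah; apply: sumr_ge0 => i _.
by rewrite mxE; apply: sumr_ge0 => j _; rewrite !mxE mul_conjC_ge0.
Qed.

(** The entry is the quadratic form of [A] at the adjoint of row [i] of [V]. *)
Lemma psdmx_congr_diag_ge0 (R : realType) (d : nat) (A V : 'M[R[i]]_d) i :
  psdmx A -> 0 <= (V *m A *m V ^t*) i i.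
Proof.
case=> _ A_ge0; have := A_ge0 ((row i V) ^t*).
have -> : ((row i V) ^t*) ^t* = row i V by apply/matrixP=> j k; rewrite !mxE conjCK.
congr (0 <= _); rewrite -row_mul 2!mxE; apply: eq_bigr => j _.
by rewrite !mxE.
Qed.

Lemma psdmx_spectral (R : realType) (d : nat) (A : 'M[R[i]]_d) : psdmx A ->
  exists V : 'M[R[i]]_d, exists D : 'rV[R[i]]_d,
  [/\ V \is unitarymx, A = V ^t* *m diag_mx D *m V & forall i, 0 <= D 0 i].
Proof.
move=> Apsd; have [/hermitian_normalmx/orthomx_spectralP AE _] := Apsd.
have Vu := spectral_unitarymx A; rewrite (invmx_unitary Vu) in AE.
exists (spectralmx A), (spectral_diag A); split=> // i.
have := psdmx_congr_diag_ge0 (spectralmx A) i Apsd.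
rewrite {2}AE !mulmxA (unitarymxP Vu) mul1mx mulmxtVK//.
by rewrite !mxE eqxx mulr1n.
Qed.

(** Diagonalizing [B] by [V] makes the trace a sum of eigenvalues of [B] times diagonal entries of
    [V *m A *m V ^t*]. *)
Lemma psdmx_mxtrace_mul_ge0 (R : realType) (d : nat) (A B : 'M[R[i]]_d) :
  psdmx A -> psdmx B -> 0 <= \tr (A *m B).
Proof.
move=> Apsd /psdmx_spectral[V [D [_ -> D_ge0]]].
rewrite !mulmxA mxtrace_mulC !mulmxA; apply: sumr_ge0 => i _.
by rewrite mul_mx_diag mxE mulr_ge0// psdmx_congr_diag_ge0.
Qed.

(** For nonnegative eigenvalues, the square of their sum exceeds the sum of their squares by
    nonnegative cross terms. *)
Lemma psdmx_mxtrace_sqr_le (R : realType) (d : nat) (A : 'M[R[i]]_d) :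
  psdmx A -> \tr (A *m A) <= (\tr A) ^+ 2.
Proof.
case/psdmx_spectral=> V [D [Vu -> D_ge0]].
have trV X : \tr (V ^t* *m X *m V) = \tr X.
  by rewrite mxtrace_mulC mulmxA (unitarymxP Vu) mul1mx.
have -> : V ^t* *m diag_mx D *m V *m (V ^t* *m diag_mx D *m V)
    = V ^t* *m (diag_mx D *m diag_mx D) *m V.
  by rewrite !mulmxA mulmxtVK.
rewrite !trV mxtrace_diag expr2 mulr_suml.
apply: ler_sum => i _; rewrite mul_mx_diag !mxE eqxx mulr1n.
by rewrite ler_wpM2l// (bigD1 i)//= lerDl sumr_ge0.
Qed.

(** * The Hilbert-Schmidt form *)

(** Taking the real part gives a real bilinear form on all matrices; [outcome_prob P rho n] unfolds
    to [hs_dot (P n) rho]. *)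
Definition hs_dot (R : realType) (d : nat) (A B : 'M[R[i]]_d) : R :=
  complex.Re (\tr (A *m B)).

Lemma hs_dotC (R : realType) (d : nat) (A B : 'M[R[i]]_d) :
  hs_dot A B = hs_dot B A.
Proof. by rewrite /hs_dot mxtrace_mulC. Qed.

Lemma hs_dotDl (R : realType) (d : nat) (A B C : 'M[R[i]]_d) :
  hs_dot (A + B) C = hs_dot A C + hs_dot B C.
Proof. by rewrite /hs_dot mulmxDl mxtraceD; case: (\tr _); case: (\tr _). Qed.

Lemma hs_dotZl (R : realType) (d : nat) (t : R) (A B : 'M[R[i]]_d) :
  hs_dot (t%:C *: A) B = t * hs_dot A B.
Proof.
by rewrite /hs_dot -scalemxAl mxtraceZ; case: (\tr _) => x y /=; rewrite mul0r subr0.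
Qed.

Lemma hs_dotDr (R : realType) (d : nat) (A B C : 'M[R[i]]_d) :
  hs_dot A (B + C) = hs_dot A B + hs_dot A C.
Proof. by rewrite !(hs_dotC A) hs_dotDl. Qed.

Lemma hs_dotZr (R : realType) (d : nat) (t : R) (A B : 'M[R[i]]_d) :
  hs_dot A (t%:C *: B) = t * hs_dot A B.
Proof. by rewrite !(hs_dotC A) hs_dotZl. Qed.

Lemma hs_dot_suml (R : realType) (d : nat) (I : finType)
    (F : I -> 'M[R[i]]_d) (B : 'M[R[i]]_d) :
  hs_dot (\sum_i F i) B = \sum_i hs_dot (F i) B.
Proof.
apply: (big_morph (fun A => hs_dot A B)) => [A C|]; first exact: hs_dotDl.
by rewrite /hs_dot mul0mx mxtrace0.
Qed.

Lemma hermsymmxD (R : realType) (d : nat) (A B : 'M[R[i]]_d) :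
  A \is hermsymmx -> B \is hermsymmx -> A + B \is hermsymmx.
Proof.
move=> /hermsymmx_trmxC Ah /hermsymmx_trmxC Bh; apply/hermsymmx_trmxC.
by rewrite linearD/= map_mxD Ah Bh.
Qed.

Lemma hermsymmxZ (R : realType) (d : nat) (t : R) (A : 'M[R[i]]_d) :
  A \is hermsymmx -> t%:C *: A \is hermsymmx.
Proof.
move=> /hermsymmx_trmxC Ah; apply/hermsymmx_trmxC.
rewrite linearZ/= map_mxZ Ah; congr (_ *: _).
by apply/CrealP; rewrite complex_real.
Qed.

Lemma hermsymmx_sum (R : realType) (d : nat) (I : finType) (F : I -> 'M[R[i]]_d) :
  (forall i, F i \is hermsymmx) -> \sum_i F i \is hermsymmx.
Proof.
move=> Fh; elim/big_rec: _ => [|i A _]; last exact: hermsymmxD.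
by apply/hermsymmx_trmxC; rewrite trmx0 map_mx0.
Qed.

Lemma hs_dot_ge0 (R : realType) (d : nat) (A : 'M[R[i]]_d) :
  A \is hermsymmx -> 0 <= hs_dot A A.
Proof. by move=> /hermsymmx_mxtrace_sqr_ge0; rewrite lecE => /andP[]. Qed.

(** * Outcome probabilities and the index of coincidence *)

Lemma outcome_prob_ge0 (R : realType) (d : nat) (P : 'I_d -> 'M[R[i]]_d)
    (rho : 'M[R[i]]_d) n : povm P -> density_matrix rho ->
  0 <= outcome_prob P rho n.
Proof.
case=> Ppsd _ [rpsd _].
by have := psdmx_mxtrace_mul_ge0 (Ppsd n) rpsd; rewrite lecE => /andP[].
Qed.

Lemma outcome_prob_sum1 (R : realType) (d : nat) (P : 'I_d -> 'M[R[i]]_d)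
    (rho : 'M[R[i]]_d) : povm P -> density_matrix rho ->
  \sum_(n < d) outcome_prob P rho n = 1.
Proof.
by case=> _ P1 [_ r1]; rewrite -(hs_dot_suml P) P1 /hs_dot mul1mx r1.
Qed.

Lemma density_hs_dot_le1 (R : realType) (d : nat) (rho : 'M[R[i]]_d) :
  density_matrix rho -> hs_dot rho rho <= 1.
Proof.
by case=> /psdmx_mxtrace_sqr_le + r1; rewrite r1 expr1n lecE => /andP[].
Qed.

(** Merges the two trace conditions: the operators [P b n] - I/d are orthogonal across measurements,
    and within one measurement their Gram matrix is a multiple of the projection onto zero-sum
    vectors. *)
Lemma mum_hs_dot (R : realType) (d M : nat) (kappa : R)
    (P : 'I_M -> 'I_d -> 'M[R[i]]_d) a b m n : (2 <= d)%N ->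
  mutually_unbiased_measurements kappa P ->
  hs_dot (P a m) (P b n) = d%:R^-1
    + (a == b)%:R * ((kappa * d%:R - 1) / (d%:R - 1)) * ((m == n)%:R - d%:R^-1).
Proof.
move=> d_ge2 [_ _ Pab Pb]; rewrite /hs_dot.
have [->|/Pab ->/=] := eqVneq a b; last by rewrite !mul0r addr0.
rewrite Pb/=.
have d0 : d%:R != 0 :> R by rewrite pnatr_eq0; case: d d_ge2 {P Pab Pb m n}.
have d1 : d%:R - 1 != 0 :> R.
  by rewrite subr_eq0 pnatr_eq1; case: d d_ge2 {P Pab Pb m n d0} => [|[]].
by case: (m == n); field; rewrite d0 d1.
Qed.

(* Cauchy-Schwarz in the form [0 <= hs_dot B B] with
   [B = A - t (rho - I/d)], [A] the sum of the [(p b n - 1/d) P b n]. *)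
Lemma mum_index_of_coincidence (R : realType) (d M : nat) (kappa : R)
    (P : 'I_M -> 'I_d -> 'M[R[i]]_d) (rho : 'M[R[i]]_d) :
  (2 <= d)%N -> d%:R^-1 <= kappa ->
  mutually_unbiased_measurements kappa P -> density_matrix rho ->
  \sum_(b < M) \sum_(n < d) (outcome_prob (P b) rho n - d%:R^-1) ^+ 2
    <= kappa - d%:R^-1.
Proof.
move=> d_ge2 kappa_ge P_mum rho_dens.
have [P_povm P_tr _ _] := P_mum.
have d0 : d%:R != 0 :> R by rewrite pnatr_eq0 -lt0n ltnW.
have d2 : 2 <= d%:R :> R by rewrite ler_nat.
pose q b n := outcome_prob (P b) rho n - d%:R^-1.
pose S := \sum_(b < M) \sum_(n < d) q b n ^+ 2.
pose A := \sum_(b < M) \sum_(n < d) (q b n)%:C *: P b n.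
pose c : R := (kappa * d%:R - 1) / (d%:R - 1).
rewrite -[X in X <= _]/S.
have q0 b : \sum_(n < d) q b n = 0.
  rewrite big_split/= outcome_prob_sum1// sumr_const card_ord mulNrn.
  by rewrite -(mulr_natr d%:R^-1) mulVf// subrr.
have dotA X : hs_dot A X = \sum_(b < M) \sum_(n < d) q b n * hs_dot (P b n) X.
  rewrite hs_dot_suml; apply: eq_bigr => b _.
  by rewrite hs_dot_suml; apply: eq_bigr => n _; rewrite hs_dotZl.
(* As each [q b] sums to 0, constant parts of the Gram matrix drop out; only the term n = m of block
   [a] survives. *)
have dotAP a m : hs_dot A (P a m) = c * q a m.
  rewrite dotA (bigD1 a)//= [X in _ + X]big1 => [|b /negPf ba]; last first.
    under eq_bigr do rewrite (mum_hs_dot _ _ _ _ d_ge2 P_mum) ba !mul0r addr0.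
    by rewrite -mulr_suml q0 mul0r.
  under eq_bigr => n _.
    rewrite (mum_hs_dot _ _ _ _ d_ge2 P_mum) eqxx mul1r -/c.
    rewrite (_ : _ * _ = q a n * (d%:R^-1 - c * d%:R^-1) + c * (q a n * (n == m)%:R));
      last by ring.
    over.
  rewrite big_split/= -mulr_suml q0 mul0r add0r addr0 -mulr_sumr (bigD1 m)//=.
  by rewrite eqxx mulr1 big1 ?addr0// => n /negPf->; rewrite mulr0.
have dotAA : hs_dot A A = c * S.
  rewrite dotA mulr_sumr; apply: eq_bigr => b _; rewrite mulr_sumr.
  by apply: eq_bigr => n _; rewrite hs_dotC dotAP expr2; ring.
have dotArho : hs_dot A rho = S.
  rewrite dotA; apply: eq_bigr => b _.
  under eq_bigr => n _.
    rewrite (_ : _ * _ = q b n ^+ 2 + q b n * d%:R^-1); last first.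
      by rewrite /q /outcome_prob /hs_dot; ring.
    over.
  by rewrite big_split/= -mulr_suml q0 mul0r addr0.
have dotA1 : hs_dot A 1%:M = 0.
  rewrite dotA big1// => b _; rewrite -[RHS](q0 b); apply: eq_bigr => n _.
  by rewrite /hs_dot mulmx1 P_tr mulr1.
have dotrho1 : hs_dot rho 1%:M = 1.
  by rewrite /hs_dot mulmx1; case: rho_dens => _ ->.
have dot11 : hs_dot (1%:M : 'M[R[i]]_d) 1%:M = d%:R.
  by rewrite /hs_dot mulmx1 mxtrace1 -(rmorph_nat (real_complex R)).
have Aherm : A \is hermsymmx.
  apply: hermsymmx_sum => b; apply: hermsymmx_sum => n; apply: hermsymmxZ.
  by have [/(_ n)[]] := P_povm b.
have S_ge0 : 0 <= S by apply: sumr_ge0 => b _; apply: sumr_ge0 => n _; exact: sqr_ge0.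
(* Expanding [hs_dot B B] leaves the factor tr rho^2 - 1/d on t^2, and tr rho^2 is at most 1. *)
have dotB t : 0 <= c * S - 2 * t * S + t ^+ 2 * (1 - d%:R^-1).
  have Bh : A + (- t)%:C *: rho + (t / d%:R)%:C *: 1%:M \is hermsymmx.
    apply: hermsymmxD; last by apply/hermsymmxZ/hermitian1mx_subproof.
    by apply: hermsymmxD => //; apply: hermsymmxZ; case: rho_dens => [[]].
  have := hs_dot_ge0 Bh.
  rewrite !hs_dotDl !hs_dotDr !hs_dotZl !hs_dotZr dotAA (hs_dotC rho A) dotArho.
  rewrite (hs_dotC _ A) (hs_dotC _ rho) dotA1 dotrho1 dot11 => h.
  have := ler_wpM2l (sqr_ge0 t) (density_hs_dot_le1 rho_dens).
  rewrite -subr_ge0 => /(addr_ge0 h); congr (0 <= _).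
  by field.
have K_gt0 : 0 < 1 - d%:R^-1 :> R by rewrite subr_gt0 invf_lt1; lra.
have [->|S_neq0] := eqVneq S 0; first by rewrite subr_ge0.
have S_gt0 : 0 < S by rewrite lt_neqAle eq_sym S_neq0.
have cE : c * (1 - d%:R^-1) = kappa - d%:R^-1.
  by rewrite /c; field; rewrite d0/= subr_eq0 gt_eqF//; lra.
rewrite -cE.
(* This [t] minimizes the quadratic, whose value there is S (c K - S) / K with K = 1 - 1/d; dividing
   by S > 0 gives S <= c K. *)
have := dotB (S / (1 - d%:R^-1)).
rewrite -(pmulr_rge0 _ K_gt0).
set K := 1 - _ in K_gt0 *.
rewrite (_ : K * _ = S * (c * K - S)); last by field; rewrite gt_eqF.
by rewrite pmulr_rge0// subr_ge0.
Qed.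

(* The averaged entropy bound *)
Local Close Scope sesquilinear_scope.
Local Close Scope complex_scope.

Theorem mainTheorem4 (R : realType) (d M : nat) (kappa : R)
    (P : 'I_M -> 'I_d -> 'M[R[i]]_d) (d_ge2 : (2 <= d)%N) (M_gt0 : (0 < M)%N)
    (kappa_bounds : d%:R^-1 <= kappa <= 1)
    (P_mum : mutually_unbiased_measurements kappa P)
    (alpha : \bar R) (alpha_ge2 : (2%:E <= alpha)%E)
    (rho : 'M[R[i]]_d) (rho_density : density_matrix rho) :
  M%:R^-1 * (\sum_(b < M) renyi_entropy alpha (outcome_prob (P b) rho))
  >= inv_subr1 alpha * ln (M%:R * d%:R / (M%:R + kappa * d%:R - 1))
     + subr2_div_subr1 alpha
       * (ln d%:R
          - ln (1 + M%:R `^ (- 2^-1) * Num.sqrt (kappa * d%:R - 1)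
                    * Num.sqrt (d%:R - 1))).
Proof.
have [kappa_ge _] := andP kappa_bounds.
have [P_povm _ _ _] := P_mum.
set p := fun b => outcome_prob (P b) rho.
have p_ge0 b n : 0 <= p b n by exact: outcome_prob_ge0.
have p1 b : \sum_n p b n = 1 by exact: outcome_prob_sum1.
have M0 : 0 < M%:R :> R by rewrite ltr0n.
have d2 : 2 <= d%:R :> R by rewrite ler_nat.
have d_gt0 : 0 < d%:R :> R by lra.
have kd : 1 <= kappa * d%:R by rewrite -ler_pdivrMr// mul1r.
pose E b := \sum_n (p b n - d%:R^-1) ^+ 2.
pose C b := \sum_n p b n ^+ 2.
pose m b := \big[Num.max/0]_n p b n.
pose s := Num.sqrt (kappa * d%:R - 1) * Num.sqrt (d%:R - 1).
(* [T] and [U] bound the means of [C b] and [m b]; the logarithmic terms of the claim are [- ln T]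
   and [- ln U]. *)
pose T := (M%:R + kappa * d%:R - 1) / (M%:R * d%:R).
pose U := (1 + M%:R `^ (- 2^-1) * s) / d%:R.
have E_le : \sum_b E b <= kappa - d%:R^-1.
  exact: mum_index_of_coincidence.
have dev0 b : \sum_n (p b n - d%:R^-1) = 0.
  rewrite big_split/= p1 sumr_const card_ord mulNrn.
  by rewrite -(mulr_natr d%:R^-1) mulVf ?subrr ?gt_eqF.
have CE b : C b = E b + d%:R^-1.
  rewrite /C /E; under [in RHS]eq_bigr => n _.
    rewrite (_ : _ ^+ 2 = p b n ^+ 2 - d%:R^-1 * (p b n + (p b n - d%:R^-1)));
      last by ring.
    over.
  by rewrite big_split/= sumrN -mulr_sumr big_split/= p1 dev0 addr0 mulr1 subrK.
have s_ge0 : 0 <= M%:R `^ (- 2^-1) * s.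
  by rewrite !mulr_ge0 ?powR_ge0 ?sqrtr_ge0.
have C_sum : \sum_b C b <= M%:R * T.
  under eq_bigr do rewrite CE.
  rewrite big_split/= sumr_const card_ord -(mulr_natl d%:R^-1) -lerBrDr.
  apply: le_trans E_le _; rewrite le_eqVlt; apply/orP; left; apply/eqP.
  by rewrite /T; field; rewrite !gt_eqF.
have m_sum : \sum_b m b <= M%:R * U.
  (* [sum0_sqr_le] for the deviations from 1/d, at an index where the maximum is attained. *)
  have m_dev b : (m b - d%:R^-1) ^+ 2 <= (d%:R - 1) / d%:R * E b.
    rewrite /m; have [k -> _] := distr_bigmax (p_ge0 b) (p1 b).
    by rewrite mulrAC ler_pdivlMr// mulrC (sum0_sqr_le k (dev0 b)).
  have dev_sum : (\sum_b (m b - d%:R^-1)) ^+ 2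
      <= M%:R * ((d%:R - 1) / d%:R * (kappa - d%:R^-1)).
    apply: le_trans (sqr_sum_le _) _; rewrite ler_pM2l//.
    apply: le_trans (ler_sum _ (fun b _ => m_dev b)) _.
    by rewrite -mulr_sumr ler_wpM2l// divr_ge0//; lra.
  have MU : M%:R * U = (M%:R * (M%:R `^ (- 2^-1) * s)) / d%:R + M%:R / d%:R.
    by rewrite /U; field; rewrite gt_eqF.
  have powM : (M%:R `^ (- 2^-1)) ^+ 2 = M%:R^-1 :> R.
    by rewrite -powR_mulrn ?powR_ge0// -powRrM mulNr mulVf ?pnatr_eq0// powR_inv1// ltW.
  rewrite -[X in X <= _](subrK (M%:R / d%:R)) MU lerD2r.
  rewrite (_ : _ - _ = \sum_b (m b - d%:R^-1)); last first.
    by rewrite big_split/= sumr_const card_ord mulNrn -(mulr_natl d%:R^-1).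
  (* Comparing squares of absolute values avoids having to settle the sign of the sum; the square of
     the right side is exactly the bound in [dev_sum]. *)
  apply: le_trans (ler_norm _) _.
  rewrite -ler_sqr ?nnegrE ?normr_ge0 ?divr_ge0 ?mulr_ge0 ?(ltW M0) ?(ltW d_gt0)//.
  rewrite real_normK ?num_real// (le_trans dev_sum)// le_eqVlt.
  apply/orP; left; apply/eqP.
  rewrite !exprMn powM !sqr_sqrtr; [|lra|lra].
  by field; rewrite !gt_eqF.
have C_gt0 b : 0 < C b by exact: distr_index_of_coincidence_gt0.
have m_gt0 b : 0 < m b.
  by rewrite /m; have [k ->] := distr_bigmax (p_ge0 b) (p1 b).
have T_gt0 : 0 < T by rewrite divr_gt0 ?mulr_gt0//; lra.
have U_gt0 : 0 < U by rewrite divr_gt0//; lra.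
have lnC := ln_mean_le M_gt0 C_gt0 T_gt0 C_sum.
have lnm := ln_mean_le M_gt0 m_gt0 U_gt0 m_sum.
rewrite -(mulrA (M%:R `^ _)) -/s -[M%:R * d%:R / _]invf_div -/T.
rewrite lnV ?posrE//.
have -> : ln d%:R - ln (1 + M%:R `^ (- 2^-1) * s) = - ln U.
  by rewrite ln_div ?opprB ?posrE//; lra.
have renyi_sum : M%:R^-1 * \sum_b (inv_subr1 alpha * - ln (C b)
      + subr2_div_subr1 alpha * - ln (m b))
    <= M%:R^-1 * \sum_b renyi_entropy alpha (p b).
  rewrite ler_pM2l ?invr_gt0//; apply: ler_sum => b _.
  exact: renyi_entropy_ge.
apply: le_trans renyi_sum; rewrite big_split/= -!mulr_sumr !sumrN mulrDr.
rewrite !(mulrCA M%:R^-1) !mulrN.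
(* The two Jensen bounds combine because both coefficients are nonnegative for alpha >= 2. *)
apply: lerD; rewrite lerN2 ler_wpM2l//.
- exact: inv_subr1_ge0.
- exact: subr2_div_subr1_ge0.
Qed.
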